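(* Let $N$ be an LG number, with $N>10^{(10^{13})}$, and let $p_r$ be the largest prime factor of $N$. Then $p_r$ is the largest prime below $\log N$.
   Context: $\log$ is the natural logarithm, $\gamma$ is the Euler–Mascheroni constant, $\sigma(n)=\sum_{d\mid n}d$, $\rho(n)=\sigma(n)/n$, and $G(n)=\rho(n)/\log\log n$. A counterexample to the Robin hypothesis is an integer $n>5040$ with $G(n)\ge e^{\gamma}$. An LG (largest $G$-value) number is a counterexample $N>5040$ at which $G$ attains its largest value among counterexamples; equivalently, $N>5040$, $G(N)\ge e^\gamma$, and $G(m)\le G(N)$ for all integers $m>5040$. (Existence of LG numbers is not asserted.) *)

(* Defs.v *)
From mathcomp Require Import all_boot all_order all_algebra.
From mathcomp Require Import all_classical all_reals all_analysis.

Set Implicit Arguments.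
Unset Strict Implicit.
Unset Printing Implicit Defensive.

Import Order.TTheory GRing.Theory Num.Theory.
Import numFieldNormedType.Exports.

Local Open Scope classical_set_scope.
Local Open Scope ring_scope.

(* [limn] returns a default value on divergent sequences; this one converges.
   The term at n = 0 is irrelevant. *)
Definition euler_gamma (R : realType) : R :=
  limn (fun n : nat => \sum_(1 <= k < n.+1) (k%:R : R)^-1 - ln (n%:R : R)).

Definition sigma (n : nat) : nat := (\sum_(d <- divisors n) d)%N.

Definition rho (R : realType) (n : nat) : R := (sigma n)%:R / n%:R.

Definition G (R : realType) (n : nat) : R := rho R n / ln (ln (n%:R : R)).

Definition robin_counterexample (R : realType) (n : nat) : Prop :=
  (5040 < n)%N /\ expR (euler_gamma R) <= G R n.

Definition LG_number (R : realType) (N : nat) : Prop :=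
  robin_counterexample R N /\
  forall m : nat, robin_counterexample R m -> G R m <= G R N.

Definition largest_prime_below (R : realType) (x : R) (p : nat) : Prop :=
  [/\ prime p, p%:R < x &
      forall q : nat, prime q -> q%:R < x -> (q <= p)%N].

(* Main.v *)
Require Import Defs.
From mathcomp Require Import all_boot all_order all_algebra.
From mathcomp Require Import all_classical all_reals all_analysis.
From mathcomp Require Import ring lra.

Set Implicit Arguments.
Unset Strict Implicit.
Unset Printing Implicit Defensive.

Import Order.TTheory GRing.Theory Num.Theory.
Import numFieldNormedType.Exports.
Local Open Scope classical_set_scope.
Local Open Scope ring_scope.

(** An LG number [N] beats every competitor [m > 5040], not only the
    counterexamples, because the others have [G m < e^gamma <= G N].  Put
    [L = ln N].  The two halves of the theorem come from comparing [N] with its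
    neighbours [q * N] and [N / p], and using [ln (1 + x) <= x].

    If a prime [q] does not divide [N], then [rho (q * N) = (1 + 1/q) rho N],
    and [G (q * N) <= G N] becomes [1 + 1/q <= ln (L + ln q) / ln L].  As
    [ln (L + ln q) <= ln L + ln q / L], this gives [L ln L <= q ln q], that is
    [L <= q].  So every prime below [L] divides [N].

    If a prime [p] divides [N] and [m = N / p], then [rho N <= (1 + 1/p) rho m]
    whatever the power of [p] in [N].  When [m > 5040], [G m <= G N] gives
    [ln L / (1 + 1/p) <= ln (L - ln p)], and the same estimate yields
    [(p + 1) ln p <= L ln L], hence [p < L].  When [m <= 5040], [N / p] is no
    legitimate competitor, but then [rho N <= 2 rho m] is small for the size of
    [N], and [5041 * m] would have a larger value of [G].  The size of [N] is
    used only there.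

    Hence the prime factors of [N] are exactly the primes below [L]. *)

(** * The sum of divisors of a multiple *)

Lemma sigma_gt0 n : (0 < n)%N -> (0 < sigma n)%N.
Proof.
move=> n0; rewrite /sigma (big_rem 1%N) ?addn_gt0 //=.
by rewrite -dvdn_divisors ?dvd1n.
Qed.

(** The divisors of [p * m] that [p] divides are the [p * e] with [e] a divisor
    of [m]; by coprimality the others are the divisors of [m] that [p] does not
    divide.  Their sum is at most [sigma m], with equality if [p] does not
    divide [m]. *)
Lemma sigma_prime_mul p m : prime p -> (0 < m)%N ->
  sigma (p * m) = (p * sigma m + \sum_(d <- divisors m | ~~ (p %| d)) d)%N.
Proof.
move=> pp m0; have p0 := prime_gt0 pp.
have pm0 : (0 < p * m)%N by rewrite muln_gt0 p0.
rewrite {1}/sigma (bigID (fun d => p %| d)%N) /=; congr (_ + _)%N.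
  rewrite /sigma big_distrr /= -(big_map (muln p) xpredT id) -big_filter.
  apply: perm_big; apply: uniq_perm.
  - exact/filter_uniq/divisors_uniq.
  - rewrite map_inj_uniq ?divisors_uniq // => x y /eqP.
    by rewrite eqn_pmul2l // => /eqP.
  move=> d; rewrite mem_filter -dvdn_divisors //; apply/andP/mapP.
    move=> [/dvdnP[e ->]]; rewrite (mulnC e) dvdn_pmul2l // => em.
    by exists e; rewrite -?dvdn_divisors.
  by move=> [e]; rewrite -dvdn_divisors // => em ->; rewrite dvdn_mulr ?dvdn_pmul2l.
rewrite -big_filter -[RHS]big_filter; apply: perm_big; apply: uniq_perm.
- exact/filter_uniq/divisors_uniq.
- exact/filter_uniq/divisors_uniq.
move=> d; rewrite !mem_filter -!dvdn_divisors //.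
case: (boolP (p %| d)%N) => //= pd.
by rewrite Gauss_dvdr // coprime_sym prime_coprime.
Qed.

Lemma sigma_prime_mul_le p m : prime p -> (0 < m)%N ->
  (sigma (p * m) <= p.+1 * sigma m)%N.
Proof.
move=> pp m0; rewrite sigma_prime_mul // mulSn addnC leq_add2r.
by rewrite /sigma [leqRHS](bigID (fun d => p %| d)%N) /= leq_addl.
Qed.

Lemma sigma_prime_mul_ndvd p m : prime p -> (0 < m)%N -> ~~ (p %| m)%N ->
  sigma (p * m) = (p.+1 * sigma m)%N.
Proof.
move=> pp m0 pm; rewrite sigma_prime_mul // mulSn addnC; congr (_ + _)%N.
rewrite /sigma big_seq_cond [RHS]big_seq; apply: eq_bigl => d.
rewrite -dvdn_divisors //; case: (boolP (d %| m)%N) => //= dm.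
by apply: contra pm => pd; exact: dvdn_trans dm.
Qed.

Lemma sigma_mul_ge a m : (0 < a)%N -> (0 < m)%N ->
  (a * sigma m <= sigma (a * m))%N.
Proof.
move=> a0 m0; rewrite /sigma big_distrr /= -(big_map (muln a) xpredT id).
apply: (uniq_sub_le_big leqnn (fun x y => leq_addr y x)).
- rewrite map_inj_uniq ?divisors_uniq // => x y /eqP.
  by rewrite eqn_pmul2l // => /eqP.
- exact: divisors_uniq.
move=> d /mapP[e]; rewrite -!dvdn_divisors ?muln_gt0 ?a0 // => em ->.
by rewrite dvdn_pmul2l.
Qed.

Lemma rho_gt0 (R : realType) (n : nat) : (0 < n)%N -> 0 < rho R n.
Proof. by move=> n0; rewrite divr_gt0 ?ltr0n ?sigma_gt0. Qed.

Lemma rho_prime_mul_le (R : realType) (p m : nat) : prime p -> (0 < m)%N ->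
  p%:R * rho R (p * m) <= (p%:R + 1) * rho R m.
Proof.
move=> pp m0; have p0 : 0 < p%:R :> R by rewrite ltr0n prime_gt0.
have m0' : 0 < m%:R :> R by rewrite ltr0n.
have -> : p%:R * rho R (p * m) = (sigma (p * m))%:R / m%:R.
  by rewrite /rho natrM; field; rewrite !gt_eqF.
rewrite /rho mulrA ler_pM2r ?invr_gt0 // natr1 -natrM ler_nat.
exact: sigma_prime_mul_le.
Qed.

Lemma rho_prime_mul_ndvd (R : realType) (p m : nat) : prime p -> (0 < m)%N -> ~~ (p %| m)%N ->
  p%:R * rho R (p * m) = (p%:R + 1) * rho R m.
Proof.
move=> pp m0 pm; have p0 : 0 < p%:R :> R by rewrite ltr0n prime_gt0.
have m0' : 0 < m%:R :> R by rewrite ltr0n.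
rewrite /rho sigma_prime_mul_ndvd // !natrM -natr1.
by field; rewrite !gt_eqF.
Qed.

Lemma rho_mul_ge (R : realType) (a m : nat) : (0 < a)%N -> (0 < m)%N -> rho R m <= rho R (a * m).
Proof.
move=> a0 m0; have a0' : 0 < a%:R :> R by rewrite ltr0n.
have m0' : 0 < m%:R :> R by rewrite ltr0n.
rewrite /rho ler_pdivrMr //.
have -> : (sigma (a * m))%:R / (a * m)%:R * m%:R = (sigma (a * m))%:R / a%:R :> R.
  by rewrite natrM; field; rewrite !gt_eqF.
by rewrite ler_pdivlMr // mulrC -natrM ler_nat sigma_mul_ge.
Qed.

(** * Estimates for the logarithm *)

(** The graph of [ln] lies below its tangent at [x].  At [x = L] this bounds
    both [ln (L + ln q)] and [ln (L - ln p)]. *)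
Lemma ln_le_tangent (R : realType) (x y : R) : 0 < x -> 0 < y -> ln y <= ln x + (y - x) / x.
Proof.
move=> x0 y0.
have -> : y = x * (1 + (y - x) / x) by field; rewrite gt_eqF.
have h : 1 + (y - x) / x = y / x by field; rewrite gt_eqF.
rewrite lnM ?posrE ?h ?divr_gt0 // -{1}h lerD2l.
have -> : (x * (y / x) - x) / x = (y - x) / x by field; rewrite gt_eqF.
apply: le_ln1Dx.
suff : 0 < 1 + (y - x) / x by lra.
by rewrite h divr_gt0.
Qed.

Lemma ln4_ge1 (R : realType) : 1 <= ln (4 : R).
Proof.
have half0 : (0 : R) < 2^-1 by rewrite invr_gt0 ltr0n.
have -> : (4 : R) = 2 ^+ 2 by ring.
have := @ln_le_tangent R 1 2^-1 ltr01 half0.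
rewrite ln1 divr1 lnV ?posrE ?ltr0n // lnXn ?ltr0n // -mulr_natr; lra.
Qed.

(** Powers of [4 >= e] give crude lower bounds on logarithms of large integers
    without evaluating these. *)
Lemma le_ln_nat (R : realType) (a n : nat) : (4 ^ a <= n)%N -> a%:R <= ln (n%:R : R).
Proof.
move=> an; have an' : (4 : R) ^+ a <= n%:R by rewrite -natrX ler_nat.
have a0 : 0 < (4 : R) ^+ a by rewrite exprn_gt0 // ltr0n.
apply: (@le_trans _ _ (ln (4 ^+ a))).
  by rewrite lnXn ?ltr0n // -[leRHS]mulr_natl ler_peMr ?ler0n // ln4_ge1.
by rewrite ler_ln // posrE // (lt_le_trans a0).
Qed.

Lemma lt_mul_ln (R : realType) (x y : R) : 1 < x -> x < y -> x * ln x < y * ln y.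
Proof.
move=> x1 xy; have x0 : 0 < x by lra.
apply: ltr_pM => //; first by lra.
- by apply: ln_ge0; lra.
- by rewrite ltr_ln // posrE //; lra.
Qed.

Lemma mul2_ln_lt (R : realType) (x y : R) :
  2 <= x -> x <= 26 -> 10 ^+ 3 <= y -> 2 * ln x < ln y.
Proof.
move=> x2 x26 y1000; have x0 : 0 < x by lra.
have xy : x ^+ 2 < y by nra.
rewrite mulr_natl -lnXn // ltr_ln // posrE ?exprn_gt0 //; lra.
Qed.

(** * Comparing an LG number with its neighbours *)

Lemma lnln_gt0 (R : realType) (m : nat) : (5040 < m)%N -> 0 < ln (ln (m%:R : R)).
Proof.
move=> m5; apply: ln_gt0; apply: (@lt_le_trans _ _ (2%:R)); first by lra.
by apply: le_ln_nat; apply: ltnW; apply: leq_ltn_trans m5.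
Qed.

(** The value at a competitor that is not a counterexample is below [e^gamma],
    so the maximality of [G N] extends to it.  Denominators are cleared because
    the comparisons below are between multiples of one value of [rho]. *)
Lemma LG_max (R : realType) (N m : nat) :
  LG_number R N -> (5040 < m)%N ->
  rho R m * ln (ln (N%:R : R)) <= rho R N * ln (ln (m%:R : R)).
Proof.
move=> [[N5 GN] maxN] m5.
have : G R m <= G R N.
  have [Gm|Gm] := leP (expR (euler_gamma R)) (G R m); first exact: maxN.
  exact: le_trans (ltW Gm) GN.
have lN := lnln_gt0 R N5; have lm := lnln_gt0 R m5.
by rewrite /G ler_pdivrMr // mulrAC ler_pdivlMr.
Qed.

(** Comparison with [q * N]: it multiplies [rho] by [1 + 1 / q] and adds only
    [ln q] to the logarithm. *)
Lemma LG_ndvd_prime_ge (R : realType) (N q : nat) :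
  LG_number R N -> prime q -> ~~ (q %| N)%N -> ln (N%:R : R) <= q%:R.
Proof.
move=> LG pq qN; have [[N5 _] _] := LG.
have N0 : (0 < N)%N by apply: leq_trans N5.
have q0n := prime_gt0 pq.
have q0 : 0 < q%:R :> R by rewrite ltr0n prime_gt0.
have q1 : 1 < q%:R :> R by rewrite ltr1n prime_gt1.
have lq := ln_gt0 q1.
have rN := rho_gt0 R N0.
have lN := lnln_gt0 R N5.
have qN5 : (5040 < q * N)%N by rewrite (leq_trans N5) // leq_pmull // prime_gt0.
have := LG_max LG qN5.
rewrite natrM lnM ?posrE ?ltr0n // -(ler_pM2l q0) mulrA rho_prime_mul_ndvd //.
set L := ln N%:R in lN *; set l := ln q%:R in lq *.
rewrite -mulrA mulrCA [_ * (rho R N * _)]mulrCA ler_pM2l // => h.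
have L2 : 2%:R <= L by apply: le_ln_nat; apply: ltnW; apply: leq_ltn_trans N5.
have L0 : 0 < L by lra.
have Ll : 0 < l + L by lra.
have := ln_le_tangent L0 Ll; rewrite addrK => t.
have h2 : (q%:R + 1) * ln L <= q%:R * (ln L + l / L).
  by apply: le_trans h _; rewrite ler_pM2l.
have h3 : L * ln L <= q%:R * l.
  have -> : q%:R * l = q%:R * (l / L) * L by field; rewrite gt_eqF.
  by rewrite mulrC ler_pM2r //; move: h2; rewrite mulrDl mulrDr mul1r lerD2l.
rewrite leNgt; apply/negP => qL.
by move: h3; rewrite leNgt lt_mul_ln.
Qed.

(** A large [N] is not [p * m] with [m] small: [rho N] would be at most
    [2 * rho m], while [5041 * m] keeps at least the value [rho m] at a bounded
    argument: [ln (5041 * m) <= 26].  The comparison then contradicts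
    [2 * ln 26 < ln (ln N)], that is [26 ^ 2 < ln N], which is where the
    threshold [10 ^ 3] comes from. *)
Lemma LG_cofactor_large (R : realType) (p m : nat) :
  LG_number R (p * m) -> prime p -> 10 ^+ 3 <= ln ((p * m)%:R : R) ->
  (5040 < m)%N.
Proof.
move=> LG pp big; have [[N5 _] _] := LG.
rewrite ltnNge; apply/negP => m5.
have m0 : (0 < m)%N by move: N5; case: (m) => //; rewrite muln0.
have p1 : 1 <= p%:R :> R by rewrite ler1n prime_gt0.
have rm := rho_gt0 R m0.
have am : (5040 < 5041 * m)%N by rewrite (@leq_trans (5041 * 1)) // leq_mul2l.
have := LG_max LG am.
have lN := lnln_gt0 R N5.
have la := lnln_gt0 R am.
set L := ln (p * m)%:R in big lN *; set X := ln (5041 * m)%:R in la *.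
have X2 : 2%:R <= X by apply: le_ln_nat; apply: ltnW; apply: leq_ltn_trans am.
(* Both factors are at most [2 ^ 13], and [ln 2 <= 1]. *)
have X26 : X <= 26.
  have am26 : (5041 * m)%:R <= (2 : R) ^+ (13 + 13).
    by rewrite -natrX ler_nat expnD leq_mul // (leq_trans m5).
  apply: (@le_trans _ _ (ln (2 ^+ (13 + 13)))).
    by rewrite ler_ln ?posrE ?exprn_gt0 ?ltr0n ?muln_gt0.
  have := @ln_le_tangent R 1 2 ltr01 ltac:(lra).
  by rewrite lnXn ?ltr0n // -[_ *+ _]mulr_natr ln1 divr1; lra.
have X2L : 2 * ln X < ln L by exact: mul2_ln_lt.
have r1 := @rho_mul_ge R 5041 m isT m0.
have r2 := rho_prime_mul_le R pp m0.
have r3 : rho R (p * m) <= 2 * rho R m.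
  rewrite -(@ler_pM2l _ p%:R) ?ltr0n ?prime_gt0 //.
  by apply: le_trans r2 _; rewrite [leRHS]mulrA ler_pM2r // mulr_natr mulr2n lerD2l.
apply/negP; rewrite -ltNge.
apply: (@le_lt_trans _ _ (rho R m * (2 * ln X))).
  by rewrite [leRHS]mulrA [rho R m * 2]mulrC ler_pM2r.
apply: (@lt_le_trans _ _ (rho R m * ln L)); first by rewrite ltr_pM2l.
by rewrite ler_pM2r.
Qed.

(** Comparison with [m = N / p].  Dividing by [p] costs [rho] a factor of at
    most [1 + 1 / p], with equality when [p] divides [N] once; so the
    multiplicity of [p] does not have to be known. *)
Lemma LG_prime_dvd_lt (R : realType) (N p : nat) :
  LG_number R N -> 10 ^+ 3 <= ln (N%:R : R) -> prime p -> (p %| N)%N ->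
  p%:R < ln (N%:R : R).
Proof.
move=> LG big pp /dvdnP[m Nmp]; move: LG big; rewrite {}Nmp mulnC => LG big.
have m5 := LG_cofactor_large LG pp big.
have [[N5 _] _] := LG.
have m0 : (0 < m)%N by apply: leq_trans m5.
have p0n := prime_gt0 pp.
have p0 : 0 < p%:R :> R by rewrite ltr0n.
have p1 : 1 < p%:R :> R by rewrite ltr1n prime_gt1.
have rm := rho_gt0 R m0.
have lm := lnln_gt0 R m5.
have lp := ln_gt0 p1.
have M2 : 2%:R <= ln (m%:R : R).
  by apply: le_ln_nat; apply: ltnW; apply: leq_ltn_trans m5.
have := LG_max LG m5; rewrite -(ler_pM2l p0) [leRHS]mulrA => h.
have h1 := le_trans h (ler_wpM2r (ltW lm) (rho_prime_mul_le R pp m0)).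
set L := ln (p * m)%:R in big h1 *.
have LE : L = ln (p%:R : R) + ln m%:R by rewrite /L natrM lnM ?posrE ?ltr0n.
set l := ln p%:R in lp LE *; set M := ln m%:R in lm M2 LE h1 *.
have L0 : 0 < L by lra.
have {h1}h2 : p%:R * ln L <= (p%:R + 1) * ln M.
  by rewrite -(ler_pM2l rm) [leLHS]mulrCA [leRHS]mulrA [rho R m * (_ + 1)]mulrC.
have M0 : 0 < M by lra.
have t : ln M <= ln L - l / L.
  have := ln_le_tangent L0 M0.
  have -> : M - L = - l by rewrite LE; ring.
  by rewrite mulNr.
have h3 : (p%:R + 1) * l <= L * ln L.
  have -> : (p%:R + 1) * l = (p%:R + 1) * (l / L) * L by field; rewrite gt_eqF.
  rewrite mulrC ler_pM2l //.
  have := le_trans h2 (ler_wpM2l (ltW (addr_gt0 p0 ltr01)) t); lra.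
rewrite ltNge; apply/negP => Lp.
have : L * ln L <= p%:R * l.
  move: Lp; rewrite le_eqVlt => /orP[/eqP Lp|Lp]; first by rewrite /l -Lp.
  by apply/ltW/lt_mul_ln => //; lra.
lra.
Qed.

Theorem theorem3 (R : realType) (N : nat)
  (hLG : LG_number R N)
  (hN : (10 ^ (10 ^ 13) < N)%N) :
  largest_prime_below (ln (N%:R : R)) (max_pdiv N).
Proof.
have big : 10 ^+ 3 <= ln (N%:R : R).
  rewrite -natrX; apply: le_ln_nat; apply: ltnW; apply: leq_ltn_trans hN.
  apply: (@leq_trans (10 ^ (10 ^ 3))%N); first by rewrite leq_exp2r.
  by rewrite leq_exp2l // leq_exp2l.
have N1 : (1 < N)%N by case: hLG => -[N5 _] _; apply: leq_trans N5.
have pN := max_pdiv_prime N1.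
split => //; first exact: LG_prime_dvd_lt hLG big pN (max_pdiv_dvd N).
move=> q pq qL; apply: max_pdiv_max; rewrite mem_primes pq (ltnW N1) /=.
by apply: contraTT qL => qN; rewrite -leNgt LG_ndvd_prime_ge.
Qed.
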